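(* For every $\beta \in (0,1)$, there exist a transitive graph $G$ (with a fixed origin $o\in\mathbb{V}(G)$) and vertices $x, y \in \mathbb{V}(G)$ such that $\|x\|_G < \|y\|_G$, but $\mathbb{P}_p(o \longleftrightarrow x) < \mathbb{P}_p(o \longleftrightarrow y)$ for every $p \in [\beta,1)$.
   Context: A graph $G=(\mathbb{V}(G),\mathbb{E}(G))$ has vertex set $\mathbb{V}(G)$ and a set of non-oriented edges $\mathbb{E}(G)\subseteq\{\{v,u\}: v,u\in\mathbb{V}(G), v\neq u\}$. For $v,u\in\mathbb{V}(G)$, $d_G(v,u)$ denotes the graph distance, i.e. the minimum number of edges of a path in $G$ from $v$ to $u$ (and $d_G(v,u)=\infty$ if no such path exists). $G$ is transitive if for every pair of vertices $v,u\in\mathbb{V}(G)$ there is a graph isomorphism of $G$ onto itself mapping $v$ to $u$. In a transitive graph an arbitrary vertex is fixed as the origin and denoted $o$, and $\|v\|_G=d_G(o,v)$ for $v\in\mathbb{V}(G)$. Bernoulli percolation on $G$ with parameter $p\in[0,1]$: each edge of $G$ is independently open with probability $p$ and closed with probability $1-p$; the corresponding probability measure is $\mathbb{P}_p$. The event $\{v\longleftrightarrow u\}$ is the set of configurations in which there exists a path of open edges connecting $v$ and $u$. *)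

(* Defs.v *)
From HB Require Import structures.
From mathcomp Require Import all_boot all_order all_algebra.
From mathcomp Require Import finmap.
From mathcomp Require Import all_classical all_reals all_analysis.
From mathcomp Require Import measurable_realfun.
From mathcomp Require Import ring lra.
Set Implicit Arguments.
Unset Strict Implicit.
Unset Printing Implicit Defensive.
Import Order.TTheory GRing.Theory Num.Theory.
Import numFieldNormedType.Exports.
Local Open Scope classical_set_scope.
Local Open Scope ring_scope.

(* The vertex set is countable (finite or infinite), so that the connection
   events below are measurable; the graph need not be connected or locally
   finite. *)
Record graph := Graph {
  vertex : countType;
  edges : {pred {fset vertex}};
  edges_card : forall e, e \in edges -> #|` e| = 2 }.

Coercion vertex : graph >-> countType.
Arguments edges : clear implicits.

Definition edge (G : graph) := {e : {fset G} | e \in edges G}.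
HB.instance Definition _ (G : graph) := Countable.on (edge G).

Definition adj (G : graph) : rel G := fun u v => [fset u; v]%fset \in edges G.

Section GraphDistance.
Context (R : realType) (G : graph).

(* A walk from u to v is u :: s with [path (adj G) u s] and [last u s = v]; it
   has [size s] edges. The infimum over the empty set is +oo. *)
Definition gdist (u v : G) : \bar R :=
  ereal_inf [set ((size s)%:R)%:E | s in
    [set s : seq G | path (@adj G) u s /\ last u s = v]].

End GraphDistance.

Definition automorphism (G : graph) (f : G -> G) :=
  bijective f /\ forall u v, adj (f u) (f v) = adj u v.

Definition transitive_graph (G : graph) :=
  forall u v : G, exists2 f, automorphism f & f u = v.

Section BernoulliProduct.
Context (E : countType).

(* The product sigma-algebra on configurations is generated by these. *)
Definition coord_events : set (set (E -> bool)) :=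
  [set [set w : E -> bool | w e] | e in [set: E]].

Definition config := g_sigma_algebraType coord_events.

Definition cylinder (A : {fset E}) (h : E -> bool) : set config :=
  [set w | forall e, e \in A -> w e = h e].

(* The coordinates are independent Bernoulli(p) variables under P. *)
Definition is_bernoulli_product (R : realType) (p : R)
    (P : probability config R) :=
  forall (A : {fset E}) (h : E -> bool),
    P (cylinder A h) = (\prod_(e <- A) (if h e then p else 1 - p))%:E.

(* For p in [0, 1] such a P exists ([bernoulli_productP]) and is unique on
   measurable sets ([bernoulli_product_unique]); [connection] below is
   measurable ([measurable_connection]). *)
Definition bernoulli_product (R : realType) (p : R) : probability config R :=
  get [set P | is_bernoulli_product p P].

End BernoulliProduct.
Arguments bernoulli_product E {R} p.

Section ProductExistence.
Context (R : realType) (p : R) (p01 : 0 <= p <= 1).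

(* Under Lebesgue measure on [0, 1[, the indicators [T^i x < p] are independent
   Bernoulli(p) variables. *)
Let T (x : R) : R := if x < p then x / p else (x - p) / (1 - p).
Let X (i : nat) (x : R) : bool := iter i T x < p.
Let q (b : option bool) : R :=
  if b is Some c then (if c then p else 1 - p) else 1.
Let p_ge0 : 0 <= p. Proof. by case/andP: p01. Qed.
Let p_le1 : p <= 1. Proof. by case/andP: p01. Qed.

Let q_ge0 b : 0 <= q b.
Proof. by rewrite /q; case: b => [[]|] //; move/andP: p01 => [? ?]; lra. Qed.

Let S n (w : nat -> option bool) : set R :=
  [set x | 0 <= x < 1 /\
    forall i, (i < n)%N -> forall b, w i = Some b -> X i x = b].

Let S_itv n (w : nat -> option bool) : (forall i, (i < n)%N -> w i <> None) ->
  exists a : R, [/\ 0 <= a, a + \prod_(i < n) q (w i) <= 1 &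
    S n w = `[a, a + \prod_(i < n) q (w i)[%classic ].
Proof.
elim: n w => [|n IHn] w wN.
  exists 0; rewrite big_ord0; split; [lra|lra|].
  rewrite /S; apply/seteqP; split => x /=; rewrite in_itv/= add0r.
    by case.
  by move=> x01; split.
have [//|a [a0 a1 Sa]] := IHn (fun i => w i.+1).
  by move=> i ni; exact: wN.
have SE x : S n.+1 w x <-> [/\ 0 <= x < 1, Some (x < p) = w 0%N &
    S n (fun i => w i.+1) (T x)].
  split=> [[x01 xw]|[x01 x0 [_ Tx]]].
    have x0 : Some (x < p) = w 0%N.
      by case: (w 0%N) (wN 0%N isT) (xw 0%N isT) => // b _ /(_ b erefl) <-.
    split => //; split => [|i ni b wb].
      rewrite /T; case: ltP => xp.
        have p0 : 0 < p by lra.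
        rewrite divr_ge0 ?ltr_pdivrMr//; lra.
      have p1 : 0 < 1 - p by lra.
      rewrite divr_ge0 ?ltr_pdivrMr//; lra.
    by rewrite -(xw i.+1 ni b wb) /X iterSr.
  split => // -[_ b|i ni b wb]; first by rewrite -x0 => -[].
  by rewrite /X iterSr; exact: Tx.
rewrite big_ord_recl/=.
under eq_bigr do rewrite /bump/= add1n.
set L := \prod_(i < n) _ in a1 Sa *.
have L0 : 0 <= L.
  by apply: prodr_ge0 => i _; exact: q_ge0.
have q_ge0' : 0 <= 1 - p by rewrite subr_ge0.
have aL : 0 <= 1 - (a + L) by rewrite subr_ge0.
have pa := mulr_ge0 p_ge0 a0; have pL := mulr_ge0 p_ge0 L0.
have paL := mulr_ge0 p_ge0 aL.
have qa := mulr_ge0 q_ge0' a0; have qL := mulr_ge0 q_ge0' L0.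
have qaL := mulr_ge0 q_ge0' aL.
case wb : (w 0%N) (wN 0%N isT) => [[]|]// _ /=.
- exists (p * a); split; [lra|lra|].
  apply/seteqP; split => x.
    move/SE => [x01]; rewrite wb => -[xp]; rewrite Sa /T xp /= in_itv/=.
    have p0 : 0 < p by lra.
    rewrite ler_pdivlMr// ltr_pdivrMr// => /andP[? ?].
    by rewrite /= in_itv/=; apply/andP; split; lra.
  rewrite /= in_itv/= => /andP[x1 x2]; apply/SE.
  have p0 : 0 < p.
    rewrite lt_neqAle; apply/andP; split; last lra.
    by apply/eqP => p0; move: x1 x2; rewrite -p0; lra.
  have xp : x < p by lra.
  split; [lra|by rewrite wb xp|].
  by rewrite Sa /T xp /= in_itv/= ler_pdivlMr// ltr_pdivrMr//; apply/andP; split; lra.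
- exists (p + (1 - p) * a); split; [lra|lra|].
  apply/seteqP; split => x.
    move/SE => [x01]; rewrite wb => -[xp]; rewrite Sa /T xp /= in_itv/=.
    move/negbT : xp; rewrite -leNgt => xp.
    have p1 : 0 < 1 - p by lra.
    rewrite ler_pdivlMr// ltr_pdivrMr// => /andP[? ?].
    by rewrite /= in_itv/=; apply/andP; split; lra.
  rewrite /= in_itv/= => /andP[x1 x2]; apply/SE.
  have p1 : 0 < 1 - p.
    rewrite lt_neqAle; apply/andP; split; last lra.
    by apply/eqP => p1; move: x1 x2; rewrite -p1; lra.
  have xp : (x < p) = false by apply/negbTE; rewrite -leNgt; lra.
  split; [lra|by rewrite wb xp|].
  by rewrite Sa /T xp /= in_itv/= ler_pdivlMr// ltr_pdivrMr//; apply/andP; split; lra.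
Qed.

Let mT : measurable_fun [set: R] T.
Proof.
apply: measurable_fun_ifT.
- exact: measurable_fun_ltr.
- exact: measurable_funM.
- by apply: measurable_funM => //; exact: measurable_funB.
Qed.

Let mX i : measurable_fun [set: R] (X i).
Proof.
apply: measurable_fun_ltr => //.
by elim: i => [|i IHi] /=; [exact: measurable_id|exact: measurableT_comp mT IHi].
Qed.

Let mS n w : measurable (S n w).
Proof.
rewrite (_ : S n w = `[0, 1[%classic `&`
    \bigcap_(i in [set i | (i < n)%N]) [set x | forall b, w i = Some b -> X i x = b]).
  apply: measurableI => //; apply: bigcap_measurableType => i ni.
  case: (w i) => [b|].
    rewrite (_ : mkset _ = X i @^-1` [set b]).
      by rewrite -[X in measurable X]setTI; exact: mX.
    by apply/seteqP; split => x /= xb; [exact: xb|move=> b' [<-]].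
  rewrite (_ : mkset _ = setT) //.
  by apply/seteqP; split => x.
by apply/seteqP; split => x /=; rewrite in_itv/=.
Qed.

Let mu_S n (w : nat -> option bool) :
  lebesgue_measure (S n w) = (\prod_(i < n) q (w i))%:E.
Proof.
suff H k v : (forall i, (k <= i < n)%N -> v i <> None) ->
    lebesgue_measure (S n v) = (\prod_(i < n) q (v i))%:E.
  by apply: (H n) => i /andP[ni]; rewrite ltnNge ni.
elim: k v => [|k IHk] v vN.
  have [//|a [a0 a1 ->]] := @S_itv n v.
  rewrite lebesgue_measure_itv/= lte_fin.
  have : 0 <= \prod_(i < n) q (v i).
    by apply: prodr_ge0 => i _; exact: q_ge0.
  case: ltP => [_ _|aL L0].
    by rewrite -EFinD; congr (_%:E); ring.
  by congr (_%:E); lra.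
case: (ltnP k n) => [kn|nk]; last first.
  apply: IHk => i /andP[ki ni].
  by have := leq_ltn_trans (leq_trans nk ki) ni; rewrite ltnn.
case vk : (v k) => [b|].
  apply: IHk => i; rewrite leq_eqVlt => /andP[/predU1P[<-|ki] ni].
    by rewrite vk.
  by apply: vN; rewrite ki.
pose u b i := if i == k then Some b else v i.
have uN b i : (k <= i < n)%N -> u b i <> None.
  rewrite /u leq_eqVlt eq_sym => /andP[/orP[->//|ki] ni].
  by case: eqP => // _; apply: vN; rewrite ki.
have uE b : lebesgue_measure (S n (u b)) =
    (q (Some b) * \prod_(i < n | i != Ordinal kn) q (v i))%:E.
  rewrite (IHk _ (uN b)) (bigD1 (Ordinal kn))//= /u eqxx.
  congr (_ * _)%:E; apply: eq_bigr => i.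
  by rewrite -val_eqE/= => /negbTE ->.
have -> : S n v = S n (u true) `|` S n (u false).
  apply/seteqP; split => x.
    move=> [x01 xv]; case Xk : (X k x); [left|right]; split => // i ni b; rewrite /u;
    by case: eqP => [->|_]; [rewrite Xk => -[]|exact: xv].
  by move=> [|] [x01 xu]; split => // i ni b vb; apply: xu => //; rewrite /u;
    case: eqP vb => // ->; rewrite vk.
have tf0 : S n (u true) `&` S n (u false) = set0.
  apply/seteqP; split => x //= [[_ xt] [_ xf]].
  have := xt k kn true; rewrite /u eqxx => /(_ erefl).
  by have := xf k kn false; rewrite /u eqxx => /(_ erefl) ->.
have -> := measureU (@lebesgue_measure R) (mS n (u true)) (mS n (u false)) tf0.
transitivity ((q (Some true) * \prod_(i < n | i != Ordinal kn) q (v i))%:E +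
    (q (Some false) * \prod_(i < n | i != Ordinal kn) q (v i))%:E)%E.
  by congr (_ + _)%E; exact: uE.
rewrite [in RHS](bigD1 (Ordinal kn))//= vk -EFinD -mulrDl.
by congr (_ * _)%:E; rewrite /q; ring.
Qed.

Context (E : countType).

Let Phi (x : R) : config E := fun e => X (choice.pickle e) x.

Let mPhi : measurable_fun [set: R] Phi.
Proof.
apply: (@measurability _ _ _ (config E) [set: R] Phi (@coord_events E)) => // _ [_ [e _ <-] <-].
rewrite setTI (_ : _ @^-1` _ = X (choice.pickle e) @^-1` [set true]).
  by rewrite -[X in measurable X]setTI; exact: mX.
by apply/seteqP; split => x.
Qed.

Let m01 : measurable (`[0, 1[%classic : set R).
Proof. by []. Qed.

Let Q : set (config E) -> \bar R :=
  pushforward (mrestr (@lebesgue_measure R) m01) Phi.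

Let Q0 : Q set0 = 0%E. Proof. exact: measure0. Qed.

Let Q_ge0 A : (0 <= Q A)%E. Proof. exact: measure_ge0. Qed.

Let Q_sigma_additive : semi_sigma_additive Q.
Proof. exact: measure_semi_sigma_additive. Qed.

HB.instance Definition _ := isMeasure.Build _ _ _ Q Q0 Q_ge0 Q_sigma_additive.

Let QT : Q setT = 1%E.
Proof.
rewrite /Q /pushforward /mrestr preimage_setT setTI lebesgue_measure_itv/=.
by rewrite lte_fin ltr01 -EFinB subr0.
Qed.

HB.instance Definition _ := Measure_isProbability.Build _ _ _ Q QT.

Lemma bernoulli_product_exists :
  exists P : probability (config E) R, is_bernoulli_product p P.
Proof.
exists Q => A h.
have [n An] : exists n, forall e, e \in A -> (choice.pickle e < n)%N.
  exists (\max_(e <- A) choice.pickle e).+1 => e eA; rewrite ltnS.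
  exact: (@leq_bigmax_seq _ _ xpredT choice.pickle).
pose w i := if pickle_inv i is Some e then
  if e \in A then Some (h e) else None else None : option bool.
have wE e : e \in A -> w (choice.pickle e) = Some (h e).
  by move=> eA; rewrite /w pickleK_inv eA.
transitivity (lebesgue_measure (S n w)).
  rewrite [LHS]/=/Q/pushforward/mrestr.
  congr (lebesgue_measure _); apply/seteqP; split => x /=.
    rewrite in_itv/= => -[xA x01]; split => // i ni b.
    rewrite /w; case eE : (pickle_inv i) => [e|//].
    case: ifP => // eA [<-]; rewrite -xA// /Phi.
    by have := @pickle_invK E i; rewrite /oapp eE => ->.
  move=> [x01 xw]; split; last by rewrite /= in_itv.
  by move=> e eA; apply: (xw _ (An _ eA)); exact: wE.
rewrite mu_S; congr (_%:E).
rewrite -(big_mkord xpredT (fun i => q (w i))) /index_iota subn0.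
rewrite (bigID (fun i => i \in map choice.pickle A))/= [X in _ * X]big1 ?mulr1.
  rewrite -big_filter (perm_big (map choice.pickle A)).
    rewrite big_map big_seq [RHS]big_seq; apply: eq_bigr => e eA.
    by rewrite wE.
  apply: uniq_perm.
  - by rewrite filter_uniq ?iota_uniq.
  - by rewrite map_inj_uniq ?fset_uniq//; exact: pcan_inj choice.pickleK.
  - move=> i; rewrite mem_filter mem_iota/= add0n.
    by apply/andb_idr => /mapP[e eA ->]; exact: An.
move=> i; rewrite /w; case eE : (pickle_inv i) => [e|//].
case: ifP => // eA /mapP[]; exists e => //.
by have := @pickle_invK E i; rewrite /oapp eE.
Qed.

End ProductExistence.

Lemma measurable_coord (E : countType) (e : E) (b : bool) :
  measurable [set w : config E | w e = b].
Proof.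
have m1 : measurable [set w : config E | w e].
  by apply: sub_sigma_algebra; exists e.
case: b => //.
rewrite (_ : mkset _ = ~` [set w : config E | w e]); first exact: measurableC.
by apply/seteqP; split => w /=; [move=> ->|move/negP/negbTE].
Qed.

Lemma measurable_cylinder (E : countType) (A : {fset E}) (h : E -> bool) :
  measurable (cylinder A h).
Proof.
rewrite (_ : cylinder A h =
    \bigcap_(e in [set e | e \in A]) [set w | w e = h e]) //.
apply: fin_bigcap_measurable => [|e _]; last exact: measurable_coord.
exact: finite_fset.
Qed.

Lemma bernoulli_productP (R : realType) (E : countType) (p : R) :
  0 <= p <= 1 -> is_bernoulli_product p (bernoulli_product E p).
Proof.
by move=> p01; apply: getPex; exact: bernoulli_product_exists.
Qed.

Lemma bernoulli_product_unique (R : realType) (E : countType) (p : R)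
    (P Q : probability (config E) R) :
  is_bernoulli_product p P -> is_bernoulli_product p Q ->
  forall A, measurable A -> P A = Q A.
Proof.
move=> PP PQ A mA.
pose G := [set C : set (config E) | C = set0 \/ exists B h, C = cylinder B h].
have GP C : G C -> P C = Q C.
  by case=> [->|[B [h ->]]]; rewrite ?measure0// PP PQ.
apply: (g_sigma_algebra_measure_unique G _ (fun=> setT)) => //.
- by move=> C [->//|[B [h ->]]]; exact: measurable_cylinder.
- move=> _; right; exists fset0, xpredT.
  by apply/seteqP; split => w.
- by rewrite bigcup_const//; exists 0%N.
- move=> C D [->|[B [h ->]]]; first by left; rewrite set0I.
  move=> [->|[B' [h' ->]]]; first by left; rewrite setI0.
  have [hh'|hh'] := pselect (forall e, e \in B -> e \in B' -> h e = h' e).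
    right; exists (B `|` B')%fset, (fun e => if e \in B then h e else h' e).
    apply/seteqP; split => w.
      move=> [wB wB'] e; rewrite inE; case: ifP => [eB _|_ /= eB'].
        exact: wB.
      exact: wB'.
    move=> w1; split => e eB; rewrite w1 ?inE ?eB ?orbT//.
    by case: ifP => // eB0; exact: hh'.
  left; apply/seteqP; split => w // [wB wB']; apply: hh' => e eB eB'.
  by rewrite -wB// wB'.
- by move=> _; rewrite [ltLHS]probability_setT ltry.
- apply: (smallest_sub _ _ mA); first exact: smallest_sigma_algebra.
  move=> _ [e _ <-]; apply: sub_sigma_algebra; right.
  exists [fset e]%fset, xpredT; apply/seteqP; split => w /=.
    by move=> we e'; rewrite inE => /eqP ->.
  by apply; rewrite inE.
Qed.

Section Percolation.
Context (G : graph).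

Definition open_adj (w : config (edge G)) : rel G := fun u v =>
  if insub [fset u; v]%fset is Some e then w e else false.

Definition connection (u v : G) : set (config (edge G)) :=
  [set w | exists s : seq G, path (open_adj w) u s /\ last u s = v].

Lemma measurable_connection u v : measurable (connection u v).
Proof.
have mo a b : measurable [set w : config (edge G) | open_adj w a b].
  rewrite /open_adj; case: insub => [e|].
    exact: (measurable_coord e true).
  by rewrite (_ : mkset _ = set0) //; apply/seteqP; split.
have mp a s : measurable [set w : config (edge G) | path (open_adj w) a s].
  elim: s a => [|b s IHs] a /=.
    by rewrite (_ : mkset _ = setT) //; apply/seteqP; split.
  rewrite (_ : mkset _ = [set w : config (edge G) | open_adj w a b] `&`
      [set w : config (edge G) | path (open_adj w) b s]).
    exact: measurableI.
  by apply/seteqP; split => w /= /andP.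
pose F (o : option (seq G)) : set (config (edge G)) := if o is Some s then
  [set w | path (open_adj w) u s /\ last u s = v] else set0.
have mF o : measurable (F o).
  case: o => [s|]; last exact: measurable0.
  have [suv|suv] := pselect (last u s = v).
    rewrite (_ : F _ = [set w | path (open_adj w) u s]) //.
    by apply/seteqP; split => w //= [].
  rewrite (_ : F _ = set0) //.
  by apply/seteqP; split => w //= [].
rewrite (_ : connection u v = \bigcup_i F (choice.unpickle i)).
  exact: bigcupT_measurable.
apply/seteqP; split => w.
  by move=> [s sw]; exists (choice.pickle s) => //; rewrite choice.pickleK.
by move=> [i _]; case: (choice.unpickle i) => // s sw; exists s.
Qed.

End Percolation.

Definition percolation (R : realType) (G : graph) (p : R) :
    probability (config (edge G)) R :=
  bernoulli_product (edge G) p.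

(* Main.v *)
Require Import Defs.
From mathcomp Require Import all_boot all_order all_algebra.
From mathcomp Require Import finmap.
From mathcomp Require Import all_classical all_reals all_analysis.
From mathcomp Require Import ring lra zify.

(* The free group on two matrices is given the generators [a] and [u^j], for odd
   [j] with [|j| <= 2n], where [u = upper 1] and [a = lower 1]. The edge joining
   [1] to [a] is a bridge of the Cayley graph, so [1] is connected to [a] with
   probability at most [p]. The vertex [u^2] is at distance 2 from [1] and has
   the [n] common neighbours [u^(2i+1)], [i < n], with it, so [1] is connected
   to [u^2] with probability at least [1 - (1 - p^2)^n], which exceeds [p] for
   all [p] in [beta, 1[ once [n] is large. Freeness, hence the bridge, comes
   from Sanov's matrix representation, by a ping-pong argument on slopes. *)

Set Implicit Arguments.
Unset Strict Implicit.
Unset Printing Implicit Defensive.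
Import Order.TTheory GRing.Theory Num.Theory.
Local Open Scope ring_scope.

(** * Graphs given by a relation, and their edges *)

Section Graphs.
Local Open Scope fset_scope.

Lemma fset2_inj (T : choiceType) (a b c d : T) :
  [fset a; b] = [fset c; d] -> (a = c /\ b = d) \/ (a = d /\ b = c).
Proof.
move=> /fsetP E.
have := E a; have := E b; have := E c; have := E d; rewrite !in_fset2 !eqxx !orbT /=.
move=> + + /esym + /esym; rewrite ![_ == c]eq_sym ![_ == d]eq_sym.
by do 4![move=> /orP[/eqP ?|/eqP ?]; subst]; auto.
Qed.

Lemma adj_neq (G : graph) (u v : G) : adj u v -> u != v.
Proof. by move=> /edges_card; rewrite cardfs2; case: eqP. Qed.

Section GraphOfRel.
Variables (T : countType) (r : rel T).
Hypotheses (r_sym : symmetric r) (r_irr : irreflexive r).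

Definition rel_edges : {pred {fset T}} :=
  fun e => `[< exists u v, r u v /\ e = [fset u; v] >].

Lemma rel_edges_card e : e \in rel_edges -> #|` e| = 2.
Proof.
move=> /asboolP[u [v [ruv ->]]]; rewrite cardfs2.
by case: eqP ruv => // ->; rewrite r_irr.
Qed.

Definition graph_of_rel := Graph rel_edges_card.

Lemma adj_graph_of_rel (u v : graph_of_rel) : adj u v = r u v.
Proof.
apply/asboolP/idP => [[a [b [rab]]]|ruv]; last by exists u, v.
by case/fset2_inj=> -[-> ->] //; rewrite r_sym.
Qed.

End GraphOfRel.

Lemma open_adj_adj (G : graph) (w : config (edge G)) (u v : G) :
  open_adj w u v -> adj u v.
Proof. by rewrite /open_adj; case: insubP. Qed.

Definition edge_of (G : graph) (u v : G) (h : adj u v) : edge G :=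
  exist (fun e => e \in edges G) [fset u; v] h.

Lemma open_adjE (G : graph) (w : config (edge G)) (u v : G) (h : adj u v) :
  open_adj w u v = w (edge_of h).
Proof. by rewrite /open_adj (insubT (fun e => e \in edges G) h). Qed.

End Graphs.

(** * Bounds on connection probabilities *)

Section Probability.
Context (R : realType).
Local Open Scope classical_set_scope.

Definition no_open_pair (E : countType) (s : seq (E * E)) : set (config E) :=
  [set w | forall z, z \in s -> ~~ (w z.1 && w z.2)].

Lemma measurable_no_open_pair (E : countType) (s : seq (E * E)) :
  measurable (no_open_pair s).
Proof.
rewrite (_ : no_open_pair s =
    \bigcap_(z in [set z | z \in s]) [set w | ~~ (w z.1 && w z.2)]) //.
apply: fin_bigcap_measurable => [|z _]; first exact: finite_seq.
rewrite (_ : mkset _ = ~` ([set w : config E | w z.1 = true] `&`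
                           [set w : config E | w z.2 = true])).
  by apply: measurableC; apply: measurableI; exact: measurable_coord.
apply/seteqP; split => w /=; first by move=> /negP h [h1 h2]; apply: h; rewrite h1.
by move=> h; apply/negP => /andP.
Qed.

(** Induction on [s]: forbidding the pair [(e, f)] removes the configurations in which [A] and both
    edges are open, which is the same event with [A] enlarged. Hence the general [A], and a factor
    [1 - p ^+ 2] per pair. *)
Lemma bernoulli_no_open_pair (E : countType) (p : R) (P : probability (config E) R)
    (s : seq (E * E)) (A : {fset E}) :
  is_bernoulli_product p P ->
  uniq (flatten [seq [:: z.1; z.2] | z <- s]) ->
  {in flatten [seq [:: z.1; z.2] | z <- s], forall e, e \notin A} ->
  P (cylinder A xpredT `&` no_open_pair s) =
    (p ^+ #|` A| * (1 - p ^+ 2) ^+ size s)%:E.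
Proof.
move=> HP; elim: s A => [|[e f] s IHs] A.
  move=> _ _; rewrite (_ : _ `&` _ = cylinder A xpredT); last first.
    by apply/seteqP; split => w // [].
  by rewrite HP /= expr0 mulr1 big_const_seq count_predT iter_mulr_1.
rewrite /= inE negb_or => /andP[/andP[ef es]] /andP[fs us] sA.
have eA : e \notin A by apply: sA; rewrite !inE eqxx.
have fA : f \notin A by apply: sA; rewrite !inE eqxx orbT.
have sA' : {in flatten [seq [:: z.1; z.2] | z <- s], forall e, e \notin A}.
  by move=> g gs; apply: sA; rewrite !inE gs !orbT.
pose A' := (e |` (f |` A))%fset.
have -> : cylinder A xpredT `&` no_open_pair ((e, f) :: s) =
  (cylinder A xpredT `&` no_open_pair s) `\` (cylinder A' xpredT `&` no_open_pair s).
  apply/seteqP; split => w.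
    move=> [wA ws]; split.
      by split => // z zs; apply: ws; rewrite inE zs orbT.
    move=> [wA' _]; move: (ws (e, f)); rewrite inE eqxx => /(_ isT) /=.
    by rewrite !wA' //= !inE eqxx ?orbT.
  move=> [[wA ws] wA']; split => // z; rewrite inE => /predU1P[->|]; last exact: ws.
  apply/negP => /= /andP[we wf]; apply: wA'; split => // g.
  by rewrite !inE => /or3P[/eqP->|/eqP->|/wA].
have mc B : measurable (cylinder B xpredT `&` no_open_pair s).
  apply: measurableI; [exact: measurable_cylinder|exact: measurable_no_open_pair].
have PD B C : measurable B -> measurable C -> P (B `\` C) = (P B - P (B `&` C))%E.
  by move=> mB mC; rewrite -measureD// (le_lt_trans (probability_le1 P _)) ?ltry.
rewrite PD //.
have -> : cylinder A xpredT `&` no_open_pair s `&` (cylinder A' xpredT `&` no_open_pair s)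
    = cylinder A' xpredT `&` no_open_pair s.
  apply/seteqP; split => w; first by case.
  by move=> [wA' ws]; do !split => //; move=> g gA; apply: wA'; rewrite !inE gA !orbT.
rewrite !IHs //; last first.
  move=> g gs; rewrite !inE !negb_or sA' // andbT; apply/andP; split.
    by apply: contraNneq es => <-.
  by apply: contraNneq fs => <-.
rewrite !cardfsU1 !inE (negbTE ef) (negbTE eA) (negbTE fA) /=.
by rewrite -EFinB; congr (_%:E); rewrite !exprS; ring.
Qed.

(** The two-edge paths through distinct [v i] share no edge, so they are open independently, each
    with probability [p ^+ 2]. *)
Lemma connection_via_common_neighbours (G : graph) (p : R) (o y : G) n
    (v : 'I_n -> G) : 0 <= p <= 1 -> injective v -> o != y ->
  (forall i, adj o (v i)) -> (forall i, adj (v i) y) ->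
  ((1 - (1 - p ^+ 2) ^+ n)%:E <= percolation G p (connection o y))%E.
Proof.
move=> p01 vI oy ov vy.
pose s := [seq (edge_of (ov i), edge_of (vy i)) | i <- enum 'I_n].
have HP := @bernoulli_productP R (edge G) p p01.
have := @bernoulli_no_open_pair _ p _ s fset0 HP.
have -> : cylinder fset0 xpredT `&` no_open_pair s = no_open_pair s.
  by apply/seteqP; split => w // [].
rewrite cardfs0 expr0 mul1r size_map size_enum_ord => Ps.
have {}Ps : percolation G p (no_open_pair s) = ((1 - p ^+ 2) ^+ n)%:E.
  apply: Ps => //; rewrite /s -map_comp /comp /=.
  have vo i : v i != o by rewrite eq_sym; exact: adj_neq.
  have o_neq_v i : o <> v i by apply/eqP/adj_neq.
  have v_neq_y i : v i <> y by apply/eqP/adj_neq.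
  elim: (enum 'I_n) (enum_uniq 'I_n) => //= i t IHt /andP[it /IHt ->].
  rewrite andbT inE negb_or -andbA; apply/and3P; split.
  - apply/eqP => /(congr1 val) /fset2_inj[] [].
      by move/o_neq_v.
    by move/eqP; rewrite (negbTE oy).
  - apply/flatten_mapP => -[j jt]; rewrite !inE.
    move=> /orP[] /eqP /(congr1 val) /fset2_inj[] [].
    + by move=> _ /vI ij; rewrite ij jt in it.
    + by move=> /o_neq_v.
    + by move=> /o_neq_v.
    + by move/eqP; rewrite (negbTE oy).
  - apply/flatten_mapP => -[j jt]; rewrite !inE.
    move=> /orP[] /eqP /(congr1 val) /fset2_inj[] [].
    + by move/esym/o_neq_v.
    + by move=> _ /esym/eqP; rewrite (negbTE oy).
    + by move=> /vI ij; rewrite ij jt in it.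
    + by move/v_neq_y.
rewrite EFinB -Ps -probability_setC; last exact: measurable_no_open_pair.
apply: le_measure; rewrite ?inE.
- by apply: measurableC; exact: measurable_no_open_pair.
- exact: measurable_connection.
move=> w /existsNP[z] /not_implyP[/mapP[i _ ->]] /negP; rewrite negbK => /andP[/= w1 w2].
by exists [:: v i; y]; rewrite /= !(open_adjE _ (ov i)) !(open_adjE _ (vy i)) w1 w2.
Qed.

(* [I] plays the role of the side of the cut that contains [o]. *)
Lemma connection_bridge (G : graph) (p : R) (o x : G) (I : G -> Prop) :
  0 <= p <= 1 -> adj o x -> I o -> ~ I x ->
  (forall u v, I u -> adj u v -> [fset u; v]%fset != [fset o; x]%fset -> I v) ->
  (percolation G p (connection o x) <= p%:E)%E.
Proof.
move=> p01 ox Io Ix HI.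
pose C : set (config (edge G)) := cylinder [fset edge_of ox]%fset xpredT.
have <- : percolation G p C = p%:E.
  by rewrite /C bernoulli_productP // big_seq_fset1.
apply: le_measure; rewrite ?inE.
- exact: measurable_connection.
- exact: measurable_cylinder.
move=> w [s [ws sx]] e; rewrite inE => /eqP -> /=.
apply: contra_notT Ix => wN; rewrite -{}sx.
(* With the bridge closed, no open edge leaves [I], so an open walk from [o] stays in it. *)
have {}HI u v : I u -> open_adj w u v -> I v.
  move=> Iu wuv; have uv := open_adj_adj wuv.
  apply: (HI _ _ Iu uv); apply: contraPneq wuv => uvE; rewrite (open_adjE _ uv).
  have -> : edge_of uv = edge_of ox by exact: val_inj.
  exact/negP.
elim: s o Io ws {ox C wN} => [//|u s IHs] v Iv /= /andP[wvu ws].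
exact: IHs (HI _ _ Iv wvu) ws.
Qed.

End Probability.

(** Both sides tend to 0 as [p] tends to 1. One factor [1 - p ^+ 2 = (1 - p) * (1 + p)] supplies
    [1 - p]; the remaining power only has to be below 1/2, uniformly for [p >= b]. *)
Lemma exists_expr_lt (R : realType) (b : R) : 0 < b < 1 ->
  exists n, forall p : R, b <= p < 1 -> (1 - p ^+ 2) ^+ n < 1 - p.
Proof.
move=> /andP[b0 b1]; have b2 : 0 < b ^+ 2 < 1 by nra.
have /cvgrPdist_lt /(_ _ (ltac:(lra) : 0 < 2^-1 :> R)) [n _ /(_ n (leqnn n))] :=
  @cvg_expr R (1 - b ^+ 2) (ltac:(by rewrite ger0_norm; lra)).
rewrite sub0r normrN ger0_norm; last by rewrite exprn_ge0; lra.
move=> nb; exists n.+1 => p /andP[bp p1].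
have pb : (1 - p ^+ 2) ^+ n <= (1 - b ^+ 2) ^+ n.
  by rewrite lerXn2r ?nnegrE; nra.
have t0 : 0 <= (1 - p ^+ 2) ^+ n by rewrite exprn_ge0; nra.
rewrite exprS; set t := (1 - p ^+ 2) ^+ n in pb t0 *.
(* [(1 - p) - (1 - p ^+ 2) * t] is twice this product plus the next one. *)
have h1 : 0 < (1 - p) * (2^-1 - t) by apply: mulr_gt0; lra.
have h2 : 0 <= (1 - p) * (1 - p) * t by rewrite !mulr_ge0; lra.
nra.
Qed.

(** * Sanov's matrices and ping-pong on slopes *)

Section Sanov.
Implicit Types (g h : 'M[int]_2) (j : int).

Definition upper j : 'M[int]_2 := 1 + (2 * j) *: delta_mx 0 1.
Definition lower j : 'M[int]_2 := 1 + (2 * j) *: delta_mx 1 0.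

Lemma sum_ord2 (F : 'I_2 -> int) : \sum_(i < 2) F i = F 0 + F 1.
Proof.
by rewrite !big_ord_recl big_ord0 addr0; congr (_ + F _); exact: val_inj.
Qed.

Lemma mul_upper g j i :
  ((g * upper j) i 0 = g i 0) * ((g * upper j) i 1 = g i 1 + 2 * j * g i 0).
Proof. by split; rewrite !mxE sum_ord2 !mxE /=; ring. Qed.

Lemma mul_lower g j i :
  ((g * lower j) i 0 = g i 0 + 2 * j * g i 1) * ((g * lower j) i 1 = g i 1).
Proof. by split; rewrite !mxE sum_ord2 !mxE /=; ring. Qed.

Lemma matrix2P g h :
  (forall i, g i 0 = h i 0 /\ g i 1 = h i 1) -> g = h.
Proof.
move=> gh; apply/matrixP => i k; have [h0 h1] := gh i.
by case: (unliftP 0 k) => [k'|] ->; rewrite // (ord1 k') (_ : lift 0 0 = 1) //;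
  exact: val_inj.
Qed.

Lemma upperD j k : upper j * upper k = upper (j + k).
Proof.
apply: matrix2P => i; rewrite !mul_upper -[upper (j + k)]mul1r !mul_upper.
by rewrite -[upper j]mul1r !mul_upper; split=> //; ring.
Qed.

Lemma lowerD j k : lower j * lower k = lower (j + k).
Proof.
apply: matrix2P => i; rewrite !mul_lower -[lower (j + k)]mul1r !mul_lower.
by rewrite -[lower j]mul1r !mul_lower; split=> //; ring.
Qed.

Lemma upper0 : upper 0 = 1.
Proof. by rewrite /upper mulr0 scale0r addr0. Qed.

Lemma lower0 : lower 0 = 1.
Proof. by rewrite /lower mulr0 scale0r addr0. Qed.

Lemma upper_unit j : upper j \is a GRing.unit.
Proof.
by apply/unitrP; exists (upper (- j)); rewrite !upperD addNr addrN upper0.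
Qed.

Lemma lower_unit j : lower j \is a GRing.unit.
Proof.
by apply/unitrP; exists (lower (- j)); rewrite !lowerD addNr addrN lower0.
Qed.

Lemma int_mul_gt0 (c d : int) : c != 0 -> d != 0 -> (0 < c * d) = ((0 < c) == (0 < d)).
Proof.
move=> c0 d0; case: (ltP 0 c) => c1; first by rewrite pmulr_rgt0 //; case: ltP.
by rewrite nmulr_rgt0 ?lt_def ?c1 1?eq_sym ?c0 //; apply/idP/idP; lia.
Qed.

(** Expands [(|c| - 1) * (|d| - 1) >= 0]; a product equal to 1 or -1 thus forces both factors to be
    1 or -1. *)
Lemma absz_mul_ge (c d : int) :
  c != 0 -> d != 0 -> (`|c|%N + `|d|%N <= `|(c * d)%R|%N + 1)%N.
Proof. rewrite -!absz_gt0 abszM; nia. Qed.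

(* Sanov: [upper 1] and [lower 1] generate a subgroup of these matrices, in
   which the diagonal entries are congruent to 1 modulo 4. *)
Definition sanov g : Prop :=
  [/\ g 0 0 * g 1 1 - g 0 1 * g 1 0 = 1, exists x, g 0 0 = 1 + 4 * x,
      exists y, g 0 1 = 2 * y & exists z, g 1 0 = 2 * z].

Lemma sanov1 : sanov 1.
Proof.
by split; rewrite !mxE //=; exists 0.
Qed.

Lemma sanov_upper g j : sanov g -> sanov (g * upper j).
Proof.
case=> dg [x gx] [y gy] [z gz]; rewrite /sanov !mul_upper; split.
- by rewrite -[RHS]dg; ring.
- by exists x.
- by exists (y + j * g 0 0); rewrite gy; ring.
- by exists z.
Qed.

Lemma sanov_lower g j : sanov g -> sanov (g * lower j).
Proof.
case=> dg [x gx] [y gy] [z gz]; rewrite /sanov !mul_lower; split.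
- by rewrite -[RHS]dg; ring.
- by exists (x + j * y); rewrite gy gx; ring.
- by exists y.
- by exists (z + j * g 1 1); rewrite gz; ring.
Qed.

(* [g] maps [e_1] to a vector of slope greater than 1; among the elements of
   the free group on [upper 1] and [lower 1], these are the reduced words
   starting with a positive power of [lower 1]. *)
Definition steep g := 0 < g 0 0 * (g 1 0 - g 0 0).

(** [upper j] fixes [e_1], so the first column does not change. *)
Lemma steep_upper g j : steep (g * upper j) = steep g.
Proof. by rewrite /steep !mul_upper. Qed.

(* The coordinates of [g e_1] and [g (lower 1) e_1] in the basis (1, 1), (0, 1)
   are odd integers [a], [b] and [a'], [b'] with [a * b' - b * a' = 2]. If only
   one of the vectors is steep, the two products have opposite signs, so all
   coordinates are 1 or -1. *)
Lemma steep_lower g : sanov g -> steep (g * lower 1) != steep g -> g = 1.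
Proof.
move=> [dg [x gx] [y gy] [z gz]] gs.
have [h0 h1 h2 h3] : [/\ g 0 0 = 1, g 0 1 = 0, g 1 0 = 0 & g 1 1 = 1].
  move: gs; rewrite /steep !mul_lower.
  have [k gk] : exists k, g 1 0 - g 0 0 = 2 * k + 1.
    by exists (z - 1 - 2 * x); rewrite gx gz; ring.
  have [k' gk'] : exists k', (g 1 0 + 2 * g 1 1) - (g 0 0 + 2 * g 0 1) = 2 * k' + 1.
    by exists (k + g 1 1 - g 0 1); have := gk; lia.
  have gx' : g 0 0 + 2 * g 0 1 = 1 + 4 * (x + y) by rewrite gx gy; ring.
  (* Since [lower 1] maps [e_1] to [e_1 + 2 e_2], this determinant is twice that of [g]. *)
  have D : (g 0 0) * (2 * k' + 1) - (2 * k + 1) * (g 0 0 + 2 * g 0 1) = 2.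
    rewrite -gk -gk'; transitivity (2 * (g 0 0 * g 1 1 - g 0 1 * g 1 0)); first by ring.
    by rewrite dg.
  rewrite !mulr1 gk gk'.
  set a := g 0 0 in gx D *; set a' := _ + _ in gx' D *.
  set b := 2 * k + 1 in gk D *; set b' := 2 * k' + 1 in gk' D *.
  have b0 : b != 0 by rewrite /b; lia.
  have b'0 : b' != 0 by rewrite /b'; lia.
  have a0 : a != 0 by lia.
  have a'0 : a' != 0 by lia.
  rewrite !int_mul_gt0 // => hs.
  have := int_mul_gt0 a0 b'0; have := int_mul_gt0 b0 a'0.
  have := absz_mul_ge a0 b'0; have := absz_mul_ge b0 a'0.
  move: D; move: (a * b') (b * a') => P Q D *.
  (* [P] and [Q] have opposite signs and differ by 2, so [P = 1] and [Q = -1]. The signs of [a] and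
     [a'] come from their being 1 modulo 4. *)
  have : [/\ a = 1, a' = 1, b = -1 & b' = 1] by split; lia.
  rewrite /a' /a => -[? ? ? ?]; split; nia.
apply: matrix2P => i; rewrite !mxE; case: (unliftP 0 i) => [i'|] -> //.
by rewrite (ord1 i') (_ : lift 0 0 = 1) //; exact: val_inj.
Qed.

Lemma upper_entries j : (upper j 0 0 = 1) * (upper j 0 1 = 2 * j).
Proof. by rewrite -[upper j]mul1r !mul_upper !mxE /= add0r mulr1. Qed.

Lemma lower_entries j :
  (lower j 0 0 = 1) * (lower j 0 1 = 0) * (lower j 1 0 = 2 * j).
Proof. by rewrite -[lower j]mul1r !mul_lower !mxE /= mulr0 addr0 add0r mulr1. Qed.

Lemma upper_inj : injective upper.
Proof.
move=> j k /(congr1 (fun g : 'M[int]_2 => g 0 1)); rewrite !upper_entries; lia.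
Qed.

(** * The Cayley graph and its left translations *)

Definition GL2Z : countType := {g : 'M[int]_2 | g \is a GRing.unit}.

Definition GL2Z_of g (gu : g \is a GRing.unit) : GL2Z :=
  exist (fun g => g \is a GRing.unit) g gu.

(* Only the component of 1 is relevant. Taking all of GL_2(Z) as vertices just
   adds copies of it, and saves describing the subgroup that it spans. *)
Definition cayley n (g h : GL2Z) : bool := `[<
  (exists j : int, [/\ odd `|j|%N, (`|j|%N <= n.*2)%N & val h = val g * upper j]) \/
  val h = val g * lower 1 \/ val g = val h * lower 1 >].

Lemma cayleyC n : symmetric (cayley n).
Proof.
suff S (g h : GL2Z) : cayley n g h -> cayley n h g by move=> g h; apply/idP/idP; exact: S.
move=> /asboolP[[j [oj jn hE]]|[?|?]]; apply/asboolP; [|by auto|by auto].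
by left; exists (- j); rewrite hE abszN -mulrA upperD addrN upper0 mulr1.
Qed.

Lemma cayley_irr n : irreflexive (cayley n).
Proof.
move=> [g gu]; apply/negP => /asboolP /=.
have gK s : g = g * s -> s = 1 by rewrite -{1}[g]mulr1 => /(mulrI gu).
move=> H; have {H}[[j [oj]] | ] :
  (exists j : int, odd `|j|%N /\ upper j = 1) \/ lower 1 = 1.
- by case: H => [[j [oj _ /gK]]|[/gK|/gK]]; [left; exists j|right|right].
- by rewrite -upper0 => /upper_inj j0; rewrite j0 in oj.
- by move=> /(congr1 (fun g : 'M[int]_2 => g 1 0)); rewrite lower_entries mxE.
Qed.

Definition cayley_graph n := graph_of_rel (@cayley_irr n).

Lemma adj_cayley n (g h : cayley_graph n) : adj g h = cayley n g h.
Proof. exact: adj_graph_of_rel (@cayleyC n) _ _ _. Qed.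

Lemma mulGL_proof (u v : GL2Z) : val u * val v \is a GRing.unit.
Proof. by rewrite unitrMr (valP u, valP v). Qed.

Definition translate (u v : GL2Z) : GL2Z := GL2Z_of (mulGL_proof u v).

Lemma translate_cayley n (w g h : GL2Z) :
  cayley n g h -> cayley n (translate w g) (translate w h).
Proof.
move=> /asboolP[[j [oj jn hE]]|[hE|gE]]; apply/asboolP => /=.
- by left; exists j; rewrite hE mulrA.
- by right; left; rewrite hE mulrA.
- by right; right; rewrite gE mulrA.
Qed.

Lemma cayley_graph_transitive n : transitive_graph (cayley_graph n).
Proof.
move=> [u uu] [v vu].
(* Edges are right multiplications, so left translation by [v / u] is an automorphism; it sends [u]
   to [v]. *)
have wu : v / u \is a GRing.unit by rewrite unitrMr // unitrV.
have wu' : u / v \is a GRing.unit by rewrite unitrMr // unitrV.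
set w := GL2Z_of wu; set w' := GL2Z_of wu'.
have K (x z : GL2Z) : val x * val z = 1 -> cancel (translate z) (translate x).
  by move=> xz g; apply: val_inj; rewrite /= mulrA xz mul1r.
have K1 : cancel (translate w) (translate w').
  by apply: K; rewrite /= mulrA divrK // divrr.
have K2 : cancel (translate w') (translate w).
  by apply: K; rewrite /= mulrA divrK // divrr.
exists (translate w); last by apply: val_inj; rewrite /= divrK.
split; first by exists (translate w').
move=> g h; rewrite !adj_cayley; apply/idP/idP; last exact: translate_cayley.
by move=> /(translate_cayley w'); rewrite !K1.
Qed.

End Sanov.

(** * The vertices [o], [x], [y] and the final comparison *)

Definition upperV j : GL2Z := GL2Z_of (upper_unit j).
Definition lowerV j : GL2Z := GL2Z_of (lower_unit j).

Lemma adj_upper n j k : odd `|k - j|%N -> (`|k - j|%N <= n.*2)%N ->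
  @adj (cayley_graph n) (upperV j) (upperV k).
Proof.
move=> okj kjn; rewrite adj_cayley; apply/asboolP; left; exists (k - j).
by split=> //=; rewrite upperD addrC subrK.
Qed.

Lemma adj_upper0_lower1 n : @adj (cayley_graph n) (upperV 0) (lowerV 1).
Proof.
by rewrite adj_cayley; apply/asboolP; right; left; rewrite /= upper0 mul1r.
Qed.

(** The generators [upper j] have odd [j], and the upper right entry excludes [lower 1] and its
    inverse. *)
Lemma nonadj_upper0_upper2 n : ~~ @adj (cayley_graph n) (upperV 0) (upperV 2).
Proof.
rewrite adj_cayley; apply/asboolP => /=.
rewrite upper0 mul1r => -[[j [oj _]]|].
  by rewrite mul1r => /upper_inj jE; rewrite -jE in oj.
by case=> /(congr1 (fun g : 'M[int]_2 => g 0 1));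
  rewrite ?mul_lower ?lower_entries ?upper_entries ?mxE.
Qed.

Lemma connection_lower1 (R : realType) n (p : R) : 0 <= p <= 1 ->
  (percolation (cayley_graph n) p
    (@connection (cayley_graph n) (upperV 0) (lowerV 1)) <= p%:E)%E.
Proof.
move=> p01.
(* The restriction to Sanov matrices matters: the edge from -1 to [- lower 1] also changes
   steepness. *)
pose I (g : GL2Z) := sanov (val g) /\ ~~ steep (val g).
apply: (@connection_bridge R (cayley_graph n) p _ _ I) => //.
- exact: adj_upper0_lower1.
- by rewrite /I /= upper0 /steep !mxE; split=> //; exact: sanov1.
- by case=> _ /=; rewrite /steep !lower_entries.
move=> u v [su nu]; rewrite adj_cayley => /asboolP uv uvN.
have lower_case (g h : GL2Z) : val h = val g * lower 1 -> sanov (val g) ->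
    [fset g; h]%fset != [fset upperV 0; lowerV 1]%fset -> steep (val h) = steep (val g).
  move=> hE sg; apply: contraNeq; rewrite hE => /(steep_lower sg) g1.
  have -> : g = upperV 0 by apply: val_inj; rewrite /= upper0.
  by have -> : h = lowerV 1 by apply: val_inj; rewrite hE g1 mul1r.
case: uv => [[j [_ _ vE]]|[vE|uE]]; rewrite /I.
- by rewrite vE steep_upper; split=> //; exact: sanov_upper.
- by rewrite (lower_case _ _ vE su uvN); split=> //; rewrite vE; exact: sanov_lower.
(* Here the edge is traversed backwards, and [steep_lower] applies at [v], which must first be shown
   to be a Sanov matrix. *)
- have sv : sanov (val v).
    have -> : val v = val u * lower (-1) by rewrite uE -mulrA lowerD addrN lower0 mulr1.
    exact: sanov_lower.
  have vuN : [fset v; u]%fset != [fset upperV 0; lowerV 1]%fset.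
    by rewrite (fsetUC [fset v]%fset).
  by split; rewrite // -(lower_case _ _ uE sv vuN).
Qed.

Theorem theorem1 (R : realType) (beta : R) (beta01 : 0 < beta < 1) :
  exists (G : graph) (o x y : G),
    [/\ transitive_graph G,
        (gdist R o x < gdist R o y)%E &
        forall p : R, beta <= p < 1 ->
          (percolation G p (connection o x) <
           percolation G p (connection o y))%E].
Proof.
have [n beta_n] := exists_expr_lt beta01.
exists (cayley_graph n), (upperV 0), (lowerV 1), (upperV 2).
have o_neq_y : upperV 0 != upperV 2 :> GL2Z.
  by apply/eqP => /(congr1 val) /upper_inj.
split; first exact: cayley_graph_transitive.
- apply: (@le_lt_trans _ _ 1%:E).
    apply: ereal_inf_lbound; exists [:: lowerV 1] => //=.
    by rewrite adj_upper0_lower1.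
  apply: (@lt_le_trans _ _ 2%:E); first by rewrite lte_fin ltr1n.
  apply: le_ereal_inf_tmp => _ [s [os sy] <-]; rewrite lee_fin ler_nat.
  case: s os sy => [_ /= oy|z [|//] /=]; first by rewrite oy eqxx in o_neq_y.
  by rewrite andbT => oz zy; move: oz; rewrite zy (negbTE (nonadj_upper0_upper2 n)).
move=> p bp; have p01 : 0 <= p <= 1 by lra.
apply: (le_lt_trans (connection_lower1 n p01)).
apply: (@lt_le_trans _ _ (1 - (1 - p ^+ 2) ^+ n)%:E).
  by rewrite lte_fin; have := beta_n _ bp; lra.
(* The exponent differences [2i + 1] and [1 - 2i] to 0 and 2 are odd and at most [2n] in absolute
   value. *)
pose v (i : 'I_n) : cayley_graph n := upperV (i.*2.+1).
apply: (@connection_via_common_neighbours R _ p _ _ n v) => //.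
- by move=> i k /(congr1 val) /upper_inj ik; apply: val_inj => /=; lia.
- by move=> i; apply: adj_upper; have := ltn_ord i; lia.
- by move=> i; apply: adj_upper; have := ltn_ord i; lia.
Qed.
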